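(* Let $f(x)=f_0x^m+\ldots+f_m$ and $g(x)=g_0x^n+\ldots+g_n$ be polynomials in $\mathbb{C}[x]$ with $f_0g_0\neq0$ and $m<n<2m+1$ (i.e. $\deg f<\deg g<2\deg f+1$). Let $F(x,y)\in\mathbb{C}[x,y]\setminus\mathbb{C}$ be an irreducible invariant algebraic curve of the Liénard dynamical system $x_t=y$, $y_t=-f(x)y-g(x)$. Then $F(x,y)$ and its cofactor take the form $$F(x,y)=\left\{\prod_{j=1}^{N-k}\{y-y_j(x)\}\,\{y-y_N(x)\}^{k}\right\}_{+},\qquad \lambda(x,y)=-Nf-(N-k)q_x-kp_x,$$ where $k=0$ or $k=1$, $N\in\mathbb{N}$, and $y_1(x),\ldots,y_N(x)$ are the following series near $x=\infty$ satisfying $yy_x+f(x)y+g(x)=0$: $$(I):\ y_j(x)=q(x)+\sum_{l=0}^{\infty}c_{m+1+l}^{(j)}x^{-l},\quad j=1,\ldots,N-k;$$ $$(II):\ y_N(x)=p(x)+\sum_{l=0}^{\infty}c_{n-m+l}^{(N)}x^{-l}$$ (the series of type (II) enters only if $k=1$). The coefficients of the series of type (II) and of the polynomials $$q(x)=-\frac{f_0}{m+1}x^{m+1}+\sum_{l=1}^{m}q_{m+1-l}x^l\in\mathbb{C}[x],\qquad p(x)=-\frac{g_0}{f_0}x^{n-m}+\sum_{l=1}^{n-m-1}p_{n-m-l}x^l\in\mathbb{C}[x]$$ are uniquely determined. The coefficients $c_{m+1}^{(j)}$, $j=1,\ldots,N-k$, are pairwise distinct. All other coefficients $c_{m+1+l}^{(j)}$,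 $l\in\mathbb{N}$, are expressible via $c_{m+1}^{(j)}$, where $j=1,\ldots,N-k$. The product over $j$ in the formula for $F$ is equal to $1$ whenever $k=1$ and $N=1$.
   Context: A polynomial $F\in\mathbb{C}[x,y]\setminus\mathbb{C}$ is an invariant algebraic curve of the Liénard system if $yF_x-\{f(x)y+g(x)\}F_y=\lambda(x,y)F$ for some $\lambda\in\mathbb{C}[x,y]$, called its cofactor. It is irreducible if $F$ is irreducible in $\mathbb{C}[x,y]$. $F$ and $cF$ with $c\in\mathbb{C}\setminus\{0\}$ are identified, so the formula for $F$ is for a suitable representative. For a formal sum $W(x,y)$ of monomials $c\,x^{q_1}y^{q_2}$ with $q_1,q_2\in\mathbb{Q}$, $c\in\mathbb{C}$, and with $q_1+q_2$ bounded from above, $\{W\}_+$ denotes the sum of those monomials for which $q_1$ and $q_2$ are both non-negative integers (the polynomial part of $W$). Series satisfy $yy_x+f(x)y+g(x)=0$ in the sense of formal substitution with termwise differentiation. ''Uniquely determined'' means determined by this equation (hence by $f$ and $g$) with no arbitrary constants; ''expressible via $c_{m+1}^{(j)}$'' means determined by $c_{m+1}^{(j)}$ together with $f$ and $g$. *)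

(* Defs.v *)
From HB Require Import structures.
From mathcomp Require Import all_boot all_order all_algebra zify.
From mathcomp Require Import boolp classical_sets fsbigop reals.
From mathcomp Require Export complex.

Set Implicit Arguments.
Unset Strict Implicit.
Unset Printing Implicit Defensive.

Import Order.TTheory GRing.Theory Num.Theory.
Local Open Scope ring_scope.

(* Formal Laurent series sum_(i <= d) a_i x^i near x = oo, i.e. in x^-1 with
   finitely many positive powers of x. The integer index is the exponent of x;
   asking for a natural bound d loses nothing, since d may be enlarged. *)
Record laurent (K : comNzRingType) := Laurent {
  lcoef :> int -> K ;
  lcoef_bound : exists d : nat, forall i : int, d%:Z < i -> lcoef i = 0
}.

HB.instance Definition _ (K : comNzRingType) := gen_eqMixin (laurent K).
HB.instance Definition _ (K : comNzRingType) := gen_choiceMixin (laurent K).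

Section LaurentRing.
Variable K : comNzRingType.
Implicit Types a b c : laurent K.

Lemma laurentP a b : (forall i, a i = b i) -> a = b.
Proof.
case: a b => [a Ha] [b Hb] /= eqab.
have E : a = b by apply/funext.
by subst b; congr Laurent; exact: Prop_irrelevance.
Qed.

Definition pick_bound a : nat := sval (cid (lcoef_bound a)).

Lemma pick_boundP a i : (pick_bound a)%:Z < i -> a i = 0.
Proof. exact: (svalP (cid (lcoef_bound a))). Qed.

Lemma laurent0_bound : exists d : nat, forall i : int, d%:Z < i -> (0 : K) = 0.
Proof. by exists 0%N. Qed.
Definition laurent0 := @Laurent K (fun=> 0) laurent0_bound.

Lemma laurent1_bound :
  exists d : nat, forall i : int, d%:Z < i -> (i == 0)%:R = 0 :> K.
Proof. by exists 0%N => i; case: eqP => // ->. Qed.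
Definition laurent1 := Laurent laurent1_bound.

Lemma laurent_opp_bound a :
  exists d : nat, forall i : int, d%:Z < i -> - a i = 0.
Proof. by exists (pick_bound a) => i /pick_boundP ->; rewrite oppr0. Qed.
Definition laurent_opp a := Laurent (laurent_opp_bound a).

Lemma laurent_add_bound a b :
  exists d : nat, forall i : int, d%:Z < i -> a i + b i = 0.
Proof.
exists (pick_bound a + pick_bound b)%N => i lti.
by rewrite !pick_boundP ?addr0//; lia.
Qed.
Definition laurent_add a b := Laurent (laurent_add_bound a b).

(* Cauchy product; the boundedness of both factors makes the support finite *)
Definition laurent_conv a b (k : int) : K := \sum_(i \in setT) a i * b (k - i).

Lemma laurent_mul_bound a b :
  exists d : nat, forall k : int, d%:Z < k -> laurent_conv a b k = 0.
Proof.
exists (pick_bound a + pick_bound b)%N => k ltk; apply: fsbig1 => i _.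
have [/pick_boundP->|lei] := ltrP (pick_bound a)%:Z i; first by rewrite mul0r.
by rewrite (@pick_boundP b) ?mulr0//; lia.
Qed.
Definition laurent_mul a b := Laurent (laurent_mul_bound a b).

Let zseq (M : nat) : seq int := map (fun i : nat => i%:Z - M%:Z) (iota 0 (2 * M).+1).

Let zseq_uniq M : uniq (zseq M).
Proof. by rewrite map_inj_uniq ?iota_uniq// => i j /addIr []. Qed.

Let mem_zseq M (i : int) : (`|i| <= M)%N -> i \in zseq M.
Proof.
move=> lei; apply/mapP; exists (absz (i + M%:Z)); last by lia.
by rewrite mem_iota; lia.
Qed.

Lemma fsumT_zseq M (F : int -> K) : (forall i, (M < `|i|)%N -> F i = 0) ->
  \sum_(i \in setT) F i = \sum_(i <- zseq M) F i.
Proof.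
move=> F0; rewrite (@bigfs _ _ _ _ (zseq M) xpredT)//.
  by apply: eq_fsbigl; apply/seteqP; split.
by move=> i _; apply: contraNeq => Fi; apply: mem_zseq; rewrite leqNgt;
  apply: contraNN Fi => /F0 ->.
Qed.

Lemma laurent_addA : associative laurent_add.
Proof. by move=> a b c; apply: laurentP => i; exact: addrA. Qed.
Lemma laurent_addC : commutative laurent_add.
Proof. by move=> a b; apply: laurentP => i; exact: addrC. Qed.
Lemma laurent_add0 : left_id laurent0 laurent_add.
Proof. by move=> a; apply: laurentP => i; exact: add0r. Qed.
Lemma laurent_addN : left_inverse laurent0 laurent_opp laurent_add.
Proof. by move=> a; apply: laurentP => i; exact: addNr. Qed.

Lemma laurent_mulC : commutative laurent_mul.
Proof.
move=> a b; apply: laurentP => k /=; rewrite /laurent_conv.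
rewrite (reindex_fsbigT (fun i => k - i)); last first.
  by exists (fun i => k - i) => i; rewrite subKr.
by apply: eq_fsbigr => i _; rewrite subKr mulrC.
Qed.

Lemma laurent_mul1 : left_id laurent1 laurent_mul.
Proof.
move=> a; apply: laurentP => k /=; rewrite /laurent_conv (@fsumT_zseq 0).
  by rewrite big_seq1 /= !subr0 mul1r.
by move=> i /=; case: eqP => [->//|_ _]; rewrite mul0r.
Qed.

Lemma laurent_convE a b (k : int) (M : nat) :
    (`|k| + pick_bound a + pick_bound b <= M)%N ->
  laurent_conv a b k = \sum_(i <- zseq M) a i * b (k - i).
Proof.
move=> leM; apply: fsumT_zseq => i lti.
have [/pick_boundP->|lei] := ltrP (pick_bound a)%:Z i; first by rewrite mul0r.
by rewrite (@pick_boundP b) ?mulr0//; lia.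
Qed.

Lemma laurent_mulDl : left_distributive laurent_mul laurent_add.
Proof.
move=> a b c; apply: laurentP => k /=.
set M := (`|k| + pick_bound a + pick_bound b + pick_bound c
          + pick_bound (laurent_add a b))%N.
rewrite !(@laurent_convE _ _ _ M) ?/M; try lia.
by rewrite -big_split; apply: eq_bigr => i _; exact: mulrDl.
Qed.

Lemma laurent_mulA : associative laurent_mul.
Proof.
move=> a b c; apply: laurentP => k /=.
pose M := (`|k| + pick_bound a + pick_bound b + pick_bound c
          + pick_bound (laurent_mul a b) + pick_bound (laurent_mul b c))%N.
pose M' := (2 * M)%N.
rewrite (@laurent_convE _ _ _ M') ?/M' ?/M; try lia.
rewrite [RHS](@laurent_convE _ _ _ M) ?/M; try lia.
rewrite -/M -/M'.
transitivity (\sum_(j <- zseq M') \sum_(s <- zseq M) a j * (b (s - j) * c (k - s))).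
  apply: eq_bigr => j _; rewrite -mulr_sumr.
  have [/pick_boundP->|lej] := ltrP (pick_bound a)%:Z j.
    by rewrite !mul0r.
  congr (_ * _); rewrite /= /laurent_conv.
  rewrite (reindex_fsbigT (fun s => s - j)); last first.
    by exists (fun s => s + j) => s; rewrite ?subrK ?addrK.
  rewrite (@fsumT_zseq M) => [|s lts].
    by apply: eq_bigr => s _; congr (_ * c _); lia.
  have [/pick_boundP->|les] := ltrP (pick_bound b)%:Z (s - j).
    by rewrite !mul0r.
  by rewrite (@pick_boundP c) ?mulr0//; move: lts; rewrite /M; lia.
rewrite exchange_big; apply: eq_big_seq => s /mapP [t]; rewrite mem_iota => ht hs.
rewrite /= (@laurent_convE _ _ _ M'); last by rewrite /M' /M; lia.
by rewrite mulr_suml; apply: eq_bigr => j _; rewrite mulrA.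
Qed.

End LaurentRing.

HB.instance Definition _ (K : comNzRingType) :=
  GRing.isZmodule.Build (laurent K) (@laurent_addA K) (@laurent_addC K)
    (@laurent_add0 K) (@laurent_addN K).

Lemma laurent1_neq0 (K : comNzRingType) : laurent1 K != 0.
Proof.
apply/eqP => /(congr1 (fun a : laurent K => a 0)) /= /eqP.
by rewrite oner_eq0.
Qed.

HB.instance Definition _ (K : comNzRingType) :=
  GRing.Zmodule_isComNzRing.Build (laurent K) (@laurent_mulA K)
    (@laurent_mulC K) (@laurent_mul1 K) (@laurent_mulDl K) (@laurent1_neq0 K).

Section LaurentOps.
Variable K : comNzRingType.

Lemma laurent_deriv_bound (a : laurent K) :
  exists d : nat, forall i : int, d%:Z < i -> a (i + 1) *~ (i + 1) = 0.
Proof.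
exists (pick_bound a) => i lti.
by rewrite pick_boundP ?mul0rz//; lia.
Qed.
Definition laurent_deriv (a : laurent K) := Laurent (laurent_deriv_bound a).

Lemma laurent_of_poly_bound (p : {poly K}) : exists d : nat,
  forall i : int, d%:Z < i -> (if 0 <= i then p`_(absz i) else 0) = 0.
Proof.
exists (size p) => i lti; case: ifP => // _.
by rewrite nth_default//; move: lti; move: (size p) => s; case: i; lia.
Qed.
Definition laurent_of_poly (p : {poly K}) := Laurent (laurent_of_poly_bound p).

Lemma laurent_of_seq_bound (c : nat -> K) : exists d : nat,
  forall i : int, d%:Z < i -> (if i <= 0 then c (absz i) else 0) = 0.
Proof. by exists 0%N => i lti; rewrite leNgt lti. Qed.
(* sum_(l >= 0) c_l x^(-l) *)
Definition laurent_of_seq (c : nat -> K) := Laurent (laurent_of_seq_bound c).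

Definition laurent_pos (a : laurent K) : {poly K} :=
  \poly_(i < (pick_bound a).+1) a i%:Z.

(* {W}_+ for W polynomial in y with Laurent series coefficients *)
Definition pos_part (W : {poly laurent K}) : {poly {poly K}} :=
  map_poly laurent_pos W.

End LaurentOps.

(* C[x,y] is {poly {poly C}}: the outer variable 'X is y, the inner one is x;
   so p(x) is p%:P, F_y is F^`() and F_x differentiates the coefficients. *)
Section Lienard.
Variable C : fieldType.
Implicit Types (f g p q : {poly C}) (F : {poly {poly C}}).

Definition derivx F : {poly {poly C}} := map_poly (fun p => p^`()) F.

Definition is_cofactor f g F (lambda : {poly {poly C}}) : Prop :=
  'X * derivx F - (f%:P * 'X + g%:P) * F^`() = lambda * F.

Definition invariant_curve f g F : Prop :=
  (forall c : C, F <> c%:P%:P) /\ exists lambda, is_cofactor f g F lambda.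

(* Mathcomp's irreducible_poly is meant for coefficients in a field, so it is
   not irreducibility in C[x,y]. *)
Definition irreducible_elt (A : unitRingType) (a : A) : Prop :=
  [/\ a != 0, a \isn't a GRing.unit
    & forall b c, a = b * c -> b \is a GRing.unit \/ c \is a GRing.unit].

Definition lienard_series f g (y : laurent C) : Prop :=
  y * laurent_deriv y + laurent_of_poly f * y + laurent_of_poly g = 0.

Definition expansion p (c : nat -> C) : laurent C :=
  laurent_of_poly p + laurent_of_seq c.

Definition shape_q (m : nat) f q : Prop :=
  q = (- (f`_m / m.+1%:R)) *: 'X^(m.+1) + \sum_(1 <= l < m.+1) q`_l *: 'X^l.

Definition shape_p (m n : nat) f g p : Prop :=
  p = (- (g`_n / f`_m)) *: 'X^(n - m) + \sum_(1 <= l < n - m) p`_l *: 'X^l.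

End Lienard.

(* Main.v *)
From HB Require Import structures.
Require Import Defs.
From mathcomp Require Import all_boot all_order all_algebra reals.
From mathcomp Require Import zify ring boolp classical_sets fsbigop.
Set Implicit Arguments.
Unset Strict Implicit.
Unset Printing Implicit Defensive.
Import Order.TTheory GRing.Theory Num.Theory.
Local Open Scope ring_scope.

(** Write E(y) = y y' + f y + g. Linearizing E at a series y of degree at most
    m + 1, with coefficient b at x^(m+1), a perturbation t x^k changes the
    coefficient of x^(m+k) of E by (b (k + m + 1) + f_0) t ([residual_perturb]).
    For type (II), b = 0 and the factor is f_0: all coefficients are determined
    and successive approximation converges ([typeII_exists],
    [typeII_unique]). For type (I), b = - f_0 / (m + 1) and the factor is b k:
    the coefficients with k > 0, that is q, are determined, the constant term is
    free provided that E(q) has no term in x^m, and the other coefficients are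
    determined by it ([typeI_principal], [typeI_exists], [typeI_unique]).

    The curve F has constant leading coefficient in y and a cofactor in C[x], by
    comparison of degrees ([cofactor_const]). Over the ring K of Laurent series
    it becomes a monic P with D P = lam P, where
    D = y d/dx - (f y + g) d/dy. It remains to split P over K into linear
    factors y - y_j with y_j a solution ([darboux_split]); this is done without
    Puiseux series, by exhibiting one root at a time. If P(yII) = 0 the
    solution of type (II) is a root. Otherwise u = P(yII) is nonzero with
    yII u' = lam u, which forces deg lam < m ([deg_cofactor_lt]). Put
    P(q + w) = sum_i G_i(x) w^i. Comparing degrees in the equation for the G_i
    shows that all G_i have degree at most 0 ([coef_bounded]) and that E(q) has
    no term in x^m if P is not constant in y ([coef_compat]). A root c of the
    polynomial sum_i G_i(oo) w^i is then the constant term of a solution y of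
    type (I), and u = P(y) has negative degree and satisfies y u' = lam u with
    deg lam < m = deg y - 1, so that u = 0 ([darboux_root_I]).

    The roots are distinct since F is irreducible
    ([irreducible_no_double_root]), so that yII occurs at most once and the roots
    of type (I) have distinct constant terms by uniqueness. The cofactor of
    y - y_j is - (y_j' + f) and cofactors add up; the polynomial part of the sum
    gives the formula for lam. *)

(** * Degrees, products and derivatives of Laurent series *)

Section LaurentDegree.
Variable K : comNzRingType.
Implicit Types (a b : laurent K) (p : {poly K}) (d i k : int).

Definition deg_le a d := forall i, d < i -> a i = 0.

(* Rewriting with these keeps sums and opposites folded, where simplification
   would unfold every ring operation down to coefficients. *)
Lemma laurentD a b i : (a + b) i = a i + b i. Proof. by []. Qed.
Lemma laurentN a i : (- a) i = - a i. Proof. by []. Qed.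
Lemma laurentB a b i : (a - b) i = a i - b i. Proof. by []. Qed.
Lemma laurent1E i : (1 : laurent K) i = (i == 0)%:R. Proof. by []. Qed.
Lemma laurentMn a n i : (a *+ n) i = a i *+ n.
Proof. by elim: n => [|n IH]; rewrite ?mulr0n // !mulrS laurentD IH. Qed.
Lemma laurent_sum (I : Type) (s : seq I) (G : I -> laurent K) i :
  (\sum_(j <- s) G j) i = \sum_(j <- s) G j i.
Proof. by elim/big_rec2: _ => // j x y _ <-. Qed.

Lemma fsumT_seq (s : seq int) (G : int -> K) : uniq s ->
  (forall i, i \notin s -> G i = 0) -> \sum_(i \in setT) G i = \sum_(i <- s) G i.
Proof.
move=> us G0; rewrite (@bigfs _ _ _ _ s xpredT)//; last by move=> i _; exact: G0.
by apply: eq_fsbigl; apply/seteqP; split.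
Qed.

Lemma deg_le_trans a d d' : deg_le a d -> d <= d' -> deg_le a d'.
Proof. by move=> ad dd' i di; apply: ad; apply: le_lt_trans di. Qed.

Lemma deg_leD a b d : deg_le a d -> deg_le b d -> deg_le (a + b) d.
Proof. by move=> ad bd i di; rewrite laurentD ad ?bd ?addr0. Qed.

Lemma deg_leN a d : deg_le a d -> deg_le (- a) d.
Proof. by move=> ad i di; rewrite laurentN ad ?oppr0. Qed.

Lemma deg_leMn a d n : deg_le a d -> deg_le (a *+ n) d.
Proof. by move=> ad i di; rewrite laurentMn ad ?mul0rn. Qed.

Lemma deg_le0 d : deg_le 0 d. Proof. by []. Qed.

Lemma deg_le1 : deg_le 1 0.
Proof. by move=> i i0; rewrite laurent1E gt_eqF. Qed.

Lemma deg_leM a b da db :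
  deg_le a da -> deg_le b db -> deg_le (a * b) (da + db).
Proof.
move=> ale ble k ltk; apply: fsbig1 => i _.
have [/ale->|lei] := ltrP da i; first by rewrite mul0r.
by rewrite (ble (k - i)) ?mulr0//; lia.
Qed.

Lemma coef_topM a b da db k :
  deg_le a da -> deg_le b db -> k = da + db -> (a * b) k = a da * b db.
Proof.
move=> ale ble ->; transitivity (\sum_(i <- [:: da]) a i * b (da + db - i)).
  apply: fsumT_seq => // i; rewrite inE => /eqP ne.
  have [/ale->|lei] := ltrP da i; first by rewrite mul0r.
  by rewrite (ble (da + db - i)) ?mulr0//; lia.
by rewrite big_seq1; congr (_ * b _); lia.
Qed.

Lemma deg_exists a : a != 0 -> exists2 d, deg_le a d & a d != 0.
Proof.
move=> a0; have [i ai] : exists i, a i != 0.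
  apply: contrapT => /forallNP h; move/eqP: a0; apply; apply: laurentP => i.
  by apply/eqP/negP => ?; apply: (h i); apply/negP.
have [B aB] := lcoef_bound a.
have ex : exists j : nat, a (B%:Z - j%:Z) != 0.
  exists (absz (B%:Z - i)).
  have leB : i <= B%:Z by rewrite leNgt; apply: contraNN ai => /aB ->.
  by rewrite gez0_abs ?subr_ge0// subKr.
case: (ex_minnP ex) => j aj minj; exists (B%:Z - j%:Z) => // k ltk.
apply/eqP; apply: contraTT isT => ak.
have leB : k <= B%:Z by rewrite leNgt; apply: contraNN ak => /aB ->.
have := minj (absz (B%:Z - k)); rewrite gez0_abs ?subr_ge0// subKr => /(_ ak).
by lia.
Qed.

Lemma lderivE a i : laurent_deriv a i = a (i + 1) *~ (i + 1).
Proof. by []. Qed.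

Lemma lderivD a b : laurent_deriv (a + b) = laurent_deriv a + laurent_deriv b.
Proof. by apply: laurentP => i; rewrite laurentD !lderivE laurentD mulrzDl. Qed.

Lemma lderivN a : laurent_deriv (- a) = - laurent_deriv a.
Proof. by apply: laurentP => i; rewrite laurentN !lderivE laurentN mulNrz. Qed.

Lemma lderivB a b : laurent_deriv (a - b) = laurent_deriv a - laurent_deriv b.
Proof. by rewrite lderivD lderivN. Qed.

Lemma lderiv0 : laurent_deriv 0 = 0 :> laurent K.
Proof. by apply: laurentP => i; rewrite lderivE mul0rz. Qed.

Lemma lderiv1 : laurent_deriv 1 = 0 :> laurent K.
Proof.
by apply: laurentP => i; rewrite lderivE laurent1E; case: eqP => [->|_];
  rewrite ?mulr0z ?mul0rz.
Qed.

Lemma lderivM a b : laurent_deriv (a * b) = laurent_deriv a * b + a * laurent_deriv b.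
Proof.
apply: laurentP => k; rewrite laurentD lderivE.
pose B := (`|k| + pick_bound a + pick_bound b).+2.
pose s : seq int := [seq (j%:Z - B%:Z)%R | j <- iota 0 (2 * B).+1].
have us : uniq s by rewrite map_inj_uniq ?iota_uniq// => j1 j2 /addIr [].
have sP i : i \notin s -> i < - B%:Z \/ B%:Z < i.
  move=> si; apply: contrapT => /not_orP [] /negP h1 /negP h2.
  move/negP: si; apply; apply/mapP; exists (absz (i + B%:Z)); last by lia.
  by rewrite mem_iota; lia.
have out (i : int) : i \notin s -> a i = 0 \/ b (k - i + 1) = 0.
  by move=> /sP[] h; [right|left]; apply: pick_boundP; move: h; rewrite /B; lia.
transitivity (\sum_(i <- s) a i * b (k + 1 - i) *~ (k + 1)).
  rewrite -mulrz_suml; congr (_ *~ _); apply: fsumT_seq => // i /out.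
  by rewrite addrAC => -[] ->; rewrite ?mul0r ?mulr0.
have -> : (laurent_deriv a * b) k = \sum_(i <- s) (a i *~ i) * b (k + 1 - i).
  rewrite /GRing.mul /= /laurent_conv (reindex_fsbigT (fun i => i - 1)); last first.
    by exists (fun i => i + 1) => i; rewrite ?subrK ?addrK.
  rewrite (@fsumT_seq s) //.
    by apply: eq_bigr => i _; rewrite lderivE subrK; congr (_ * b _); lia.
  move=> i /out; rewrite lderivE subrK => -[] h.
    by rewrite h mul0rz mul0r.
  by rewrite (_ : k - (i - 1) = k - i + 1) ?h ?mulr0//; lia.
have -> : (a * laurent_deriv b) k = \sum_(i <- s) a i * (b (k + 1 - i) *~ (k + 1 - i)).
  rewrite /GRing.mul /= /laurent_conv (@fsumT_seq s) //.
    by apply: eq_bigr => i _; rewrite addrAC.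
  by move=> i /out[] h; rewrite ?lderivE h ?mul0r// mul0rz mulr0.
rewrite -big_split /=; apply: eq_bigr => i _.
by rewrite mulrzAr mulrzAl -mulrzDr; congr (_ *~ _); lia.
Qed.

Lemma deg_le_lderiv a d : deg_le a d -> deg_le (laurent_deriv a) (d - 1).
Proof. by move=> ad i di; rewrite lderivE ad ?mul0rz//; lia. Qed.

Lemma ofpolyE p i :
  laurent_of_poly p i = if 0 <= i then p`_(absz i) else 0.
Proof. by []. Qed.

Lemma ofpoly_nat p (i : nat) : laurent_of_poly p i%:Z = p`_i.
Proof. by []. Qed.

Lemma ofpoly_inj : injective (@laurent_of_poly K).
Proof. by move=> p q pq; apply/polyP => i; rewrite -!ofpoly_nat pq. Qed.

Lemma deg_le_ofpoly p d : (size p)%:Z <= d + 1 -> deg_le (laurent_of_poly p) d.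
Proof.
move=> sp i di; rewrite ofpolyE; case: ifP => // i0; rewrite nth_default//.
by move: (size p) sp => s; lia.
Qed.

Lemma ofpolyB_is : zmod_morphism (@laurent_of_poly K).
Proof.
move=> p q; apply: laurentP => i; rewrite laurentB !ofpolyE coefB.
by case: ifP; rewrite ?subr0.
Qed.

Lemma ofpolyM_is : monoid_morphism (@laurent_of_poly K).
Proof.
split=> [|p q].
  by apply: laurentP; case=> [[|i]|i]; rewrite ofpolyE laurent1E ?coef1.
apply: laurentP; case=> [n|n].
  rewrite ofpoly_nat coefM.
  transitivity (\sum_(i <- map Posz (iota 0 n.+1)) laurent_of_poly p i *
     laurent_of_poly q (n%:Z - i)).
    rewrite big_map -[iota _ _]/(index_iota 0 n.+1) big_mkord.
    by apply: eq_bigr; case=> i /= lti _; rewrite subzn// -ltnS.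
  symmetry; apply: fsumT_seq; first by rewrite map_inj_uniq ?iota_uniq// => i j [].
  move=> [i|i] ni; last by rewrite mul0r.
  rewrite (_ : laurent_of_poly q _ = 0) ?mulr0// ofpolyE ifF//.
  apply/negbTE; apply: contraNN ni => le; apply/mapP; exists i => //.
  by rewrite mem_iota; lia.
symmetry; apply: fsbig1 => -[i|i] _; last by rewrite mul0r.
by rewrite (_ : laurent_of_poly q _ = 0) ?mulr0// ofpolyE ifF//; lia.
Qed.

HB.instance Definition _ :=
  GRing.isZmodMorphism.Build {poly K} (laurent K) (@laurent_of_poly K) ofpolyB_is.
HB.instance Definition _ :=
  GRing.isMonoidMorphism.Build {poly K} (laurent K) (@laurent_of_poly K) ofpolyM_is.

Lemma ofpoly_deriv p : laurent_deriv (laurent_of_poly p) = laurent_of_poly p^`().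
Proof.
apply: laurentP; case=> i; rewrite lderivE.
  by rewrite (_ : i%:Z + 1 = i.+1%:Z) ?ofpoly_nat ?coef_deriv//; lia.
case: i => [|i]; first by rewrite mulr0z.
by rewrite (_ : Negz i.+1 + 1 = Negz i) ?mul0rz//; lia.
Qed.

Lemma laurent_posK : cancel (@laurent_of_poly K) (@laurent_pos K).
Proof.
move=> p; apply/polyP => i; rewrite coef_poly ofpoly_nat; case: ifP => // h.
by rewrite -ofpoly_nat pick_boundP//; lia.
Qed.

Lemma laurent_pos0 : laurent_pos (0 : laurent K) = 0.
Proof. by rewrite -[X in laurent_pos X](rmorph0 (@laurent_of_poly K)) laurent_posK. Qed.

Lemma coef_laurent_pos (a : laurent K) (i : nat) : (laurent_pos a)`_i = a i%:Z.
Proof. by rewrite coef_poly; case: ifP => // h; rewrite pick_boundP//; lia. Qed.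

Lemma monom_bound (t : K) (k : int) :
  exists d : nat, forall i : int, d%:Z < i -> (if i == k then t else 0) = 0.
Proof. by exists (absz k) => i; case: eqP => // ->; lia. Qed.
Definition laurent_monom (t : K) (k : int) := Laurent (monom_bound t k).

Lemma deg_le_monom t k : deg_le (laurent_monom t k) k.
Proof. by move=> i ki /=; rewrite gt_eqF. Qed.

End LaurentDegree.

(** * The residual of the equation and successive approximation *)

Section Residual.
Variables (C : numFieldType) (f g : {poly C}) (m : nat).
Implicit Types (y : laurent C) (k : int) (b : C).
Notation lop := (@laurent_of_poly C).
Notation "a ^'" := (laurent_deriv a).

(** Vanishing of the residual unfolds to [lienard_series f g y]; the theorem is
    about its zeros, and the construction below makes its degree drop. *)
Definition residual y : laurent C := y * y^' + lop f * y + lop g.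

(** Both kinds of solutions have degree at most m + 1: the coefficient b of
    x^(m+1) is nonzero for type (I) and zero for type (II), which allows the
    same perturbation argument for both. *)
Definition has_lead b y := deg_le y m.+1 /\ y m.+1%:Z = b.

(** The indicial polynomial of the equation linearized at a series with leading
    coefficient b: it is the factor by which a perturbation of degree k is
    multiplied, in degree m + k. Its zeros are the exponents at which an
    arbitrary constant can enter. *)
Definition indicial b k : C := b * (k + m.+1%:Z)%:~R + f`_m.

Lemma has_lead_perturb b y1 y2 k :
  has_lead b y2 -> deg_le (y1 - y2) k -> k <= m%:Z -> has_lead b y1.
Proof.
move=> [d2 e2] dk km.
have h i : m%:Z < i -> y1 i = y2 i.
  by move=> mi; apply/eqP; rewrite -subr_eq0 -laurentB dk//; lia.
split; first by move=> i mi; rewrite h ?d2//; lia.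
by rewrite h ?e2//; lia.
Qed.

(** Step j cancels the coefficient of x^(m+k) of the residual by correcting the
    coefficient of x^k, for k = k0 - j, and so it never touches again what was
    fixed before. *)
Fixpoint approx b (y0 : laurent C) (k0 : int) (j : nat) : laurent C :=
  if j is j'.+1 then
    let y := approx b y0 k0 j' in
    let k := k0 - j'%:Z in
    y - laurent_monom (residual y (m%:Z + k) / indicial b k) k
  else y0.

Section Approx.
Variables (b : C) (y0 : laurent C) (k0 : int).
Notation Y := (approx b y0 k0).

Lemma approx_step j i : k0 - j%:Z < i -> Y (j.+1) i = Y j i.
Proof. by move=> h /=; rewrite gt_eqF ?subr0. Qed.

Lemma approx_stable j j' i : (j <= j')%N -> k0 - j%:Z < i -> Y j' i = Y j i.
Proof.
move=> /subnKC <-; elim: (j' - j)%N => [|l IH] h; first by rewrite addn0.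
by rewrite addnS approx_step ?IH//; lia.
Qed.

Lemma deg_approx j : deg_le (Y j - y0) k0.
Proof.
elim: j => [|j IH] i hi; first by rewrite subrr.
by rewrite laurentB approx_step ?[LHS]IH//; lia.
Qed.

(** The coefficient of x^i is final from step k0 - i + 1 on, so the limit of
    the approximations can be read off diagonally. *)
Lemma limit_bound : exists d : nat, forall i : int, d%:Z < i ->
  Y (`|k0 - i|%N).+1 i = 0.
Proof.
have [B hB] := lcoef_bound y0; exists (B + `|k0|)%N => i hi.
have := @deg_approx (`|k0 - i|%N).+1 i; rewrite laurentB hB ?subr0; last by lia.
by apply; lia.
Qed.

Hypotheses (y0b : has_lead b y0) (k0m : k0 <= m%:Z).

Lemma has_lead_approx j : has_lead b (Y j).
Proof. exact: has_lead_perturb y0b (deg_approx j) k0m. Qed.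

End Approx.

Hypothesis size_f : (size f <= m.+1)%N.

Lemma deg_le_f : deg_le (lop f) m.
Proof. by apply: deg_le_ofpoly; rewrite -PoszD lez_nat addn1. Qed.

Lemma residualB y1 y2 :
  residual y1 - residual y2 = y1 * (y1 - y2)^' + (y2^' + lop f) * (y1 - y2).
Proof. by rewrite /residual lderivB; ring. Qed.

Lemma deg_le_slope b y : has_lead b y -> deg_le (y^' + lop f) m.
Proof.
move=> [dy _]; apply: deg_leD deg_le_f.
by apply: deg_le_trans (deg_le_lderiv dy) _; lia.
Qed.

Lemma coef_slope b y : has_lead b y ->
  (y^' + lop f) m = b * m.+1%:R + f`_m.
Proof.
move=> [_ yb]; rewrite laurentD lderivE ofpoly_nat (_ : m%:Z + 1 = m.+1%:Z).
  by rewrite yb -mulrzr.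
by lia.
Qed.

(** The difference of two residuals is y1 d' + (y2' + f) d with d = y1 - y2, and
    the first two coefficients of y1 and y2' + f at the top depend only on b.
    Existence and uniqueness of series solutions both follow from this. *)
Lemma residual_perturb b y1 y2 k :
    has_lead b y1 -> has_lead b y2 -> deg_le (y1 - y2) k ->
  deg_le (residual y1 - residual y2) (m%:Z + k) /\
  (residual y1 - residual y2) (m%:Z + k) = indicial b k * (y1 - y2) k.
Proof.
move=> h1 h2 dk; rewrite residualB; have [d1 e1] := h1.
have dd := deg_le_lderiv dk; have ds := deg_le_slope h2.
have dM1 := deg_leM d1 dd; split.
  by apply: deg_leD (deg_leM ds dk); apply: deg_le_trans dM1 _; lia.
rewrite [LHS]laurentD (coef_topM d1 dd); last by lia.
rewrite (coef_topM ds dk)// (coef_slope h2) e1 lderivE subrK /indicial.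
by rewrite -mulrzr rmorphD /=; ring.
Qed.

Section Convergence.
Variables (b : C) (y0 : laurent C) (k0 : int).
Notation Y := (approx b y0 k0).

Hypotheses (y0b : has_lead b y0) (k0m : k0 <= m%:Z).

Lemma residual_approx j : deg_le (residual y0) (m%:Z + k0) ->
    (forall i : nat, (i < j)%N -> indicial b (k0 - i%:Z) != 0) ->
  deg_le (residual (Y j)) (m%:Z + k0 - j%:Z).
Proof.
move=> r0; elim: j => [|j IH] hj; first by rewrite subr0.
have {}IH : deg_le (residual (Y j)) (m%:Z + (k0 - j%:Z)).
  by rewrite addrA; apply: IH => i ij; apply: hj; lia.
set k := k0 - j%:Z in IH; pose t := residual (Y j) (m%:Z + k) / indicial b k.
have d : deg_le (Y j.+1 - Y j) k.
  rewrite /= -/k -/t addrAC subrr add0r; apply/deg_leN/deg_le_monom.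
have [dr er] := residual_perturb (has_lead_approx y0b k0m j.+1) (has_lead_approx y0b k0m j) d.
have -> : residual (Y j.+1) = (residual (Y j.+1) - residual (Y j)) + residual (Y j).
  by rewrite subrK.
move=> i hi; have [lti|] := ltrP (m%:Z + k) i.
  by rewrite laurentD dr ?IH ?addr0.
move=> lei; have -> : i = m%:Z + k by rewrite /k in lei *; lia.
rewrite laurentD er [X in _ * X](_ : _ = - t); last first.
  by rewrite laurentB /= -/k -/t eqxx addrAC subrr add0r.
by rewrite mulrN /t mulrC divfK ?addNr// hj.
Qed.

(** The residual of the j-th approximation has degree at most m + k0 - j, and
    that of the limit differs from it by terms of no larger degree. *)
Lemma residual_solve : deg_le (residual y0) (m%:Z + k0) ->
    (forall k, k <= k0 -> indicial b k != 0) ->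
  exists2 y, residual y = 0 & deg_le (y - y0) k0.
Proof.
move=> r0 hk; pose y := Laurent (limit_bound b y0 k0).
have dy j : deg_le (y - Y j) (k0 - j%:Z).
  move=> i hi; pose l := (`|k0 - i|%N).+1; rewrite laurentB -[y i]/(Y l i).
  have hl : k0 - l%:Z < i by rewrite /l; lia.
  have [le|/ltnW le] := leqP j l; first by rewrite (approx_stable _ _ le) ?subrr.
  by rewrite -(approx_stable _ _ le) ?subrr.
have yb : has_lead b y.
  by apply: has_lead_perturb y0b (_ : deg_le _ k0) k0m; have := dy 0; rewrite subr0.
exists y; last by have := dy 0; rewrite subr0.
apply: laurentP => i; pose j := (absz (m%:Z + k0 - i)%R).+1.
have ltj : m%:Z + k0 - j%:Z < i by rewrite /j; lia.
have [dr _] := residual_perturb yb (has_lead_approx y0b k0m j) (dy j).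
rewrite -[residual y](subrK (residual (Y j))) laurentD dr; last by lia.
rewrite (@residual_approx j) ?addr0// => l _; apply: hk; lia.
Qed.

End Convergence.

(** The difference of two approximate solutions cannot have a degree d > e,
    since its leading term would show in the residuals in degree m + d. *)
Lemma residual_inj b y1 y2 (e : int) :
    has_lead b y1 -> has_lead b y2 ->
    (forall k, e < k -> indicial b k != 0) ->
    deg_le (residual y1 - residual y2) (m%:Z + e) ->
  deg_le (y1 - y2) e.
Proof.
move=> h1 h2 hk dr; have [/eqP->|/deg_exists[d dd nz]] := boolP (y1 - y2 == 0).
  exact: deg_le0.
have [_ er] := residual_perturb h1 h2 dd.
have [lt|le] := ltrP e d; last exact: deg_le_trans le.
move: er; rewrite dr; last by lia.
by move/esym/eqP; rewrite mulf_eq0 (negbTE nz) (negbTE (hk _ lt)).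
Qed.

End Residual.

(** * Series of type (I) and (II) *)

Lemma coef_sum_monomials (R : nzRingType) (p : {poly R}) (D i : nat) :
  (\sum_(1 <= l < D) p`_l *: 'X^l)`_i = if (0 < i < D)%N then p`_i else 0.
Proof.
have -> : \sum_(1 <= l < D) p`_l *: 'X^l =
    \poly_(l < D) (if l == 0%N then 0 else p`_l).
  rewrite poly_def -(big_mkord xpredT (fun l => (if l == 0 then 0 else p`_l) *: 'X^l)).
  case: D => [|D]; first by rewrite !big_geq.
  rewrite [RHS]big_ltn// scale0r add0r.
  by apply: eq_big_nat => l /andP[l0 _]; rewrite ifN -?lt0n.
by rewrite coef_poly; case: i => [|i]; rewrite ?ltnS //=; case: ifP.
Qed.

(** The equations defining [shape_q] and [shape_p], in terms of coefficients. *)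
Lemma shapeP (R : nzRingType) (p : {poly R}) (D : nat) (c : R) : (0 < D)%N ->
  p = c *: 'X^D + \sum_(1 <= l < D) p`_l *: 'X^l <->
  [/\ p`_0 = 0, p`_D = c & forall i, (D < i)%N -> p`_i = 0].
Proof.
move=> D0; have E i : (c *: 'X^D + \sum_(1 <= l < D) p`_l *: 'X^l)`_i =
    c * (i == D)%:R + if (0 < i < D)%N then p`_i else 0.
  by rewrite coefD coefZ coefXn coef_sum_monomials.
split=> [h|[p0 pD pgt]].
  split=> [||i Di]; rewrite h E.
  - by rewrite ltn_eqF// mulr0 add0r.
  - by rewrite eqxx mulr1 ltnn andbF addr0.
  - by rewrite gtn_eqF// mulr0 add0r [(i < D)%N]ltnNge (ltnW Di) andbF.
apply/polyP => i; rewrite E; case: (ltngtP i D) => [lt|gt|->].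
- by rewrite mulr0 add0r andbT; case: i lt => [|i] _; rewrite ?p0.
- by rewrite mulr0 add0r andbF pgt.
- by rewrite mulr1 andbF addr0 pD.
Qed.

Section Expansion.
Variables (C : numFieldType).
Notation lop := (@laurent_of_poly C).

Lemma expansionE (p : {poly C}) c (i : int) : p`_0 = 0 ->
  expansion p c i = if 0 < i then p`_(absz i) else c (absz i).
Proof.
move=> p0; rewrite laurentD ofpolyE /=; case: (ltrgtP i 0) => [|_|->].
- by rewrite add0r.
- by rewrite addr0.
- by rewrite p0 add0r.
Qed.

Lemma expansion_inj (p p' : {poly C}) c c' : p`_0 = 0 -> p'`_0 = 0 ->
  expansion p c = expansion p' c' -> p = p' /\ forall l, c l = c' l.
Proof.
move=> p0 p'0 e.
have h i : expansion p c i = expansion p' c' i by rewrite e.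
split=> [|l].
  apply/polyP => -[|i]; first by rewrite p0 p'0.
  by have := h i.+1%:Z; rewrite !expansionE.
have := h (- l%:Z); rewrite !expansionE// !abszN.
by rewrite ltNge oppr_le0.
Qed.

Lemma expansion_principal (p : {poly C}) (y : laurent C) : p`_0 = 0 -> deg_le (y - lop p) 0 ->
  y = expansion p (fun l => y (- l%:Z)).
Proof.
move=> p0 d; apply: laurentP => i; rewrite expansionE//; case: ifP => i0.
  have := d i i0; rewrite laurentB => /subr0_eq ->.
  by rewrite ofpolyE ltW.
by congr (y _); lia.
Qed.

(** The constant term is left to the series in x^(-1), following the convention
    of the expansions of types (I) and (II). *)
Definition principal_part (y : laurent C) : {poly C} := laurent_pos y - (y 0)%:P.

Lemma coef_principal_part y i :
  (principal_part y)`_i = if i == 0%N then 0 else y i%:Z.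
Proof.
rewrite coefB coef_laurent_pos coefC; case: eqP => [->|_]; rewrite ?subrr ?subr0//.
Qed.

Lemma principal_partP y : deg_le (y - lop (principal_part y)) 0.
Proof.
by case=> [[|i]|i]// _; rewrite laurentB ofpoly_nat coef_principal_part subrr.
Qed.

End Expansion.

Lemma has_lead0_le (C : numFieldType) (m d : nat) (y : laurent C) :
  (d <= m)%N -> deg_le y d -> has_lead m 0 y.
Proof. by move=> dm dy; split=> [i hi|]; apply: dy; lia. Qed.

Lemma shape_p_expansion_lead (C : numFieldType) (m n : nat) (f g p : {poly C}) c :
    (m < n)%N -> (n < 2 * m + 1)%N -> shape_p m n f g p ->
  has_lead m 0 (expansion p c).
Proof.
move=> lt_mn lt_n2m /shapeP[|p0 pm pgt]; first by lia.
apply: (@has_lead0_le _ _ (n - m)); first by lia.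
by case=> i im //; rewrite laurentD ofpoly_nat pgt//= add0r; case: i im.
Qed.

Section Series.
Variables (C : numFieldType) (m n : nat) (f g : {poly C}).
Hypotheses (size_f : size f = m.+1).
Notation lop := (@laurent_of_poly C).
Notation E := (residual f g).
Notation cls := (@has_lead C m).
Notation indic := (indicial f m).

Definition typeI_lead : C := - (f`_m / m.+1%:R).

Lemma lead_f_neq0 : f`_m != 0.
Proof.
have := lead_coef_eq0 f; rewrite lead_coefE size_f => ->.
by rewrite -size_poly_eq0 size_f.
Qed.

Lemma typeI_lead_neq0 : typeI_lead != 0.
Proof. by rewrite oppr_eq0 mulf_neq0 ?lead_f_neq0// invr_neq0// pnatr_eq0. Qed.

Lemma typeI_leadM : typeI_lead * m.+1%:R = - f`_m.
Proof. by rewrite /typeI_lead mulNr divfK// pnatr_eq0. Qed.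

(** Only the exponent k = 0 is resonant for type (I): the coefficient of x^0 is
    the single arbitrary constant. *)
Lemma indicialI k : indic typeI_lead k = typeI_lead * k%:~R.
Proof.
by rewrite /indicial intrD mulrDr -pmulrn typeI_leadM -addrA addNr addr0.
Qed.

Lemma indicialI_neq0 k : k != 0 -> indic typeI_lead k != 0.
Proof. by move=> k0; rewrite indicialI mulf_neq0 ?typeI_lead_neq0// intr_eq0. Qed.

(** No exponent is resonant for type (II). *)
Lemma indicialII k : indic 0 k = f`_m.
Proof. by rewrite /indicial mul0r add0r. Qed.

Lemma leq_size_f : (size f <= m.+1)%N. Proof. by rewrite size_f. Qed.
Hint Resolve leq_size_f : core.

Lemma shape_q_expansion_lead q c : shape_q m f q -> cls typeI_lead (expansion q c).
Proof.
move=> /shapeP[]// q0 qm qgt; split=> [|]; last first.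
  by rewrite laurentD ofpoly_nat qm /= addr0.
by case=> i im //; rewrite laurentD ofpoly_nat qgt//= add0r; case: i im.
Qed.

Lemma shape_q_lead q : shape_q m f q -> cls typeI_lead (lop q).
Proof.
move=> /shapeP[]// q0 qm qgt; split=> [|]; last by rewrite ofpoly_nat qm.
by case=> i im //; rewrite ofpoly_nat qgt.
Qed.

(** All exponents k > 0 are non-resonant, so the principal part is forced. *)
Lemma typeI_principal q y : shape_q m f q -> deg_le (E (lop q)) m -> cls typeI_lead y ->
  E y = 0 -> deg_le (y - lop q) 0.
Proof.
move=> sq rq yc ey; apply: (residual_inj (g := g) leq_size_f yc (shape_q_lead sq)).
  by move=> k k0; apply: indicialI_neq0; rewrite gt_eqF.
by rewrite ey sub0r addr0; apply: deg_leN rq.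
Qed.

(** A difference of degree 0 is the resonant one, and it is excluded by equality
    of the coefficients of x^0. *)
Lemma typeI_unique y y' : E y = 0 -> E y' = 0 -> cls typeI_lead y -> cls typeI_lead y' ->
  deg_le (y - y') 0 -> y 0 = y' 0 -> y = y'.
Proof.
move=> e e' c c' d0 h; have [/eqP|/deg_exists[d dd nz]] := boolP (y - y' == 0).
  by move/subr0_eq.
have [_] := residual_perturb g leq_size_f c c' dd.
rewrite e e' subrr => /esym/eqP; rewrite mulf_eq0 (negbTE nz) orbF.
case: (ltrgtP d 0) => [lt|gt|eq]; rewrite ?(negbTE (indicialI_neq0 _))//.
- by rewrite lt_eqF.
- by move: nz; rewrite d0// eqxx.
- by move: nz; rewrite eq laurentB h subrr eqxx.
Qed.

(** The hypothesis E q m = 0 is the Fredholm compatibility condition at the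
    resonance k = 0: adding a constant c to q does not change this coefficient,
    and once it vanishes every c extends to a solution. *)
Lemma typeI_exists q (c : C) : shape_q m f q -> deg_le (E (lop q)) m ->
    E (lop q) m = 0 ->
  exists2 y, E y = 0 & cls typeI_lead y /\ deg_le (y - lop q - lop c%:P) (-1).
Proof.
move=> sq rq rm; pose y0 := lop q + lop c%:P.
have qc := shape_q_lead sq.
have d0 : deg_le (y0 - lop q) 0.
  rewrite /y0 addrAC subrr add0r; apply: deg_le_ofpoly.
  by rewrite size_polyC; case: eqP.
have c0 : cls typeI_lead y0 by apply: has_lead_perturb qc d0 _; lia.
have [dr er] := residual_perturb g leq_size_f c0 qc d0.
have r0 : deg_le (E y0) (m%:Z + -1).
  move=> i hi; rewrite -[E y0](subrK (E (lop q))) laurentD.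
  have [lt|le] := ltrP m%:Z i; first by rewrite rq// dr ?addr0//; lia.
  have -> : i = m%:Z + 0 by lia.
  by rewrite er indicialI mulr0 mul0r addr0 rm addr0.
have [|k km|y y0' dy] := residual_solve leq_size_f c0 _ r0.
- by lia.
- by apply: indicialI_neq0; lia.
exists y => //; split; first by apply: has_lead_perturb c0 dy _; lia.
by rewrite -addrA -opprD.
Qed.

Lemma typeII_unique y y' : E y = 0 -> E y' = 0 -> cls 0 y -> cls 0 y' -> y = y'.
Proof.
move=> e e' c c'; apply: laurentP => i; apply/eqP; rewrite -subr_eq0 -laurentB.
apply/eqP; apply: (residual_inj (g := g) leq_size_f c c' (e := i - 1)); last by lia.
  by move=> k _; rewrite indicialII lead_f_neq0.
by rewrite e e' subrr; exact: deg_le0.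
Qed.

Hypotheses (size_g : size g = n.+1).
Hypotheses (lt_mn : (m < n)%N) (lt_n2m : (n < 2 * m + 1)%N).

Lemma deg_le_g : deg_le (lop g) n.
Proof. by apply: deg_le_ofpoly; rewrite size_g -PoszD lez_nat addn1. Qed.

Lemma has_lead_monom : cls typeI_lead (laurent_monom typeI_lead m.+1).
Proof. by split; [exact: deg_le_monom|rewrite /= eqxx]. Qed.

(** The coefficient of x^(2m+1) is (m + 1) a^2 + f_0 a for y = a x^(m+1), which
    the choice of a kills; g does not contribute because n < 2m + 1. *)
Lemma residual_monom : deg_le (E (laurent_monom typeI_lead m.+1)) (m%:Z + m%:Z).
Proof.
set y := laurent_monom _ _ => i hi; rewrite /residual.
have dy : deg_le y m.+1 by exact: deg_le_monom.
have df := deg_le_f leq_size_f.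
have dd : deg_le (laurent_deriv y) m.
  by apply: deg_le_trans (deg_le_lderiv dy) _; lia.
rewrite laurentD [lop g i](deg_le_g); last by lia.
rewrite addr0 laurentD.
have [lt|ge] := ltrP (m.+1%:Z + m%:Z) i.
  by rewrite (deg_leM dy dd)// (deg_leM df dy) ?addr0//; lia.
have ei : i = m.+1%:Z + m%:Z by lia.
rewrite (coef_topM dy dd ei) (coef_topM df dy); last by lia.
rewrite lderivE (_ : m%:Z + 1 = m.+1%:Z); last by lia.
by rewrite [y _]/= eqxx -mulrzr -pmulrn typeI_leadM mulrN ofpoly_nat mulrC addNr.
Qed.

(** The m steps k = m, ..., 1 precede the resonance, hence this holds even when
    no solution of type (I) exists. *)
Lemma typeI_polynomial_exists : exists q, shape_q m f q /\ deg_le (E (lop q)) m.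
Proof.
pose y0 := laurent_monom typeI_lead m.+1; pose y := approx f g m typeI_lead y0 m m.
have yc : cls typeI_lead y by apply: has_lead_approx => //; exact: has_lead_monom.
have ry : deg_le (E y) m.
  have := @residual_approx _ f g m leq_size_f typeI_lead y0 m has_lead_monom (lexx _) m
    residual_monom; rewrite addrK; apply.
  by move=> i im; apply: indicialI_neq0; lia.
pose q := principal_part y.
have dq : deg_le (lop q - y) 0.
  by rewrite -opprB; apply/deg_leN/principal_partP.
have qc : cls typeI_lead (lop q) by apply: has_lead_perturb yc dq _; lia.
exists q; split.
  apply/shapeP => //; split=> [||i im]; rewrite coef_principal_part//.
    exact: yc.2.
  by case: i im => // i im; rewrite yc.1.
have [+ _] := residual_perturb g leq_size_f qc yc dq.
by rewrite addr0 => h; rewrite -[E _](subrK (E y)); apply: deg_leD.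
Qed.

Lemma residual0 : E 0 = lop g.
Proof. by rewrite /residual mul0r mulr0 !add0r. Qed.

(** Starting from 0, whose residual is g, of degree m + (n - m). *)
Lemma typeII_exists : exists y, [/\ E y = 0, deg_le y (n - m)%N &
   y (n - m)%N = - (g`_n / f`_m)].
Proof.
have [|||y y0] :=
  @residual_solve _ f g m leq_size_f 0 0 (n - m)%N (conj (@deg_le0 _ _) erefl).
- by lia.
- by rewrite residual0; apply: deg_le_trans deg_le_g _; lia.
- by move=> k _; rewrite indicialII lead_f_neq0.
rewrite subr0 => dy; exists y; split=> //.
have yc : cls 0 y by apply: (has_lead0_le _ dy); lia.
have class0 : cls 0 0 by [].
have [] := @residual_perturb _ f g m leq_size_f 0 y 0 (n - m)%N yc class0.
  by rewrite subr0.
move=> _; rewrite residual0 y0 subr0 sub0r indicialII laurentN.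
rewrite (_ : m%:Z + (n - m)%N = n%:Z) ?ofpoly_nat; last by lia.
by move=> h; apply: (mulfI lead_f_neq0); rewrite -h mulrN mulrC divfK ?lead_f_neq0.
Qed.

End Series.

(** * Darboux polynomials with Laurent series coefficients *)

Section Derivation.
Variable K : comNzRingType.
Implicit Types (P Q : {poly laurent K}) (y : laurent K).
Notation "a ^'" := (laurent_deriv a).

Definition dx P : {poly laurent K} := map_poly (@laurent_deriv K) P.

Lemma coef_dx P i : (dx P)`_i = (P`_i)^'.
Proof. by rewrite coef_map_id0 ?lderiv0. Qed.

Lemma dxD P Q : dx (P + Q) = dx P + dx Q.
Proof. by apply/polyP => i; rewrite coefD !coef_dx coefD lderivD. Qed.

Lemma dxC y : dx y%:P = (y^')%:P.
Proof. by apply/polyP => i; rewrite coef_dx !coefC; case: ifP; rewrite ?lderiv0. Qed.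

Lemma dxX : dx 'X = 0.
Proof.
apply/polyP => i; rewrite coef_dx coefX coef0.
by case: eqP => _; rewrite ?lderiv0 ?lderiv1.
Qed.

Lemma lderiv_sum (I : Type) (s : seq I) (G : I -> laurent K) :
  (\sum_(i <- s) G i)^' = \sum_(i <- s) (G i)^'.
Proof.
by elim/big_rec2: _ => [|i x y _ <-]; rewrite ?lderiv0 ?lderivD.
Qed.

Lemma dxM P Q : dx (P * Q) = dx P * Q + P * dx Q.
Proof.
apply/polyP => i; rewrite coefD coef_dx !coefM lderiv_sum -big_split /=.
by apply: eq_bigr => j _; rewrite !coef_dx lderivM.
Qed.

(** The two chain rules below express that [dx] differentiates in x at fixed y. *)
Lemma dx_comp P Q :
  dx (P \Po Q) = (dx P \Po Q) + (P^`() \Po Q) * dx Q.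
Proof.
elim/poly_ind: P => [|P c IH].
  by rewrite comp_poly0 deriv0 comp_poly0 mul0r addr0 /dx map_poly0 comp_poly0.
rewrite comp_polyD comp_polyM comp_polyX comp_polyC !dxD !dxM IH dxX !dxC.
rewrite mulr0 addr0 derivD derivM derivX derivC addr0 mulr1.
by rewrite !comp_polyD !comp_polyM comp_polyX comp_polyC; ring.
Qed.

Lemma lderiv_horner P y : (P.[y])^' = (dx P).[y] + P^`().[y] * y^'.
Proof.
elim/poly_ind: P => [|P c IH].
  by rewrite deriv0 !horner0 lderiv0 /dx map_poly0 horner0 mul0r addr0.
rewrite !dxD dxM dxX dxC derivD derivM derivX derivC !hornerE.
by rewrite lderivD lderivM IH; ring.
Qed.

End Derivation.

Section Darboux.
Variables (C : numFieldType) (f g : {poly C}).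
Notation lop := (@laurent_of_poly C).
Notation E := (residual f g).
Notation "a ^'" := (laurent_deriv a).
Implicit Types (P Q : {poly laurent C}) (y lam : laurent C).

Definition vfield P := 'X * dx P - ((lop f)%:P * 'X + (lop g)%:P) * P^`().
(** Over the field of Laurent series an invariant curve becomes a Darboux
    polynomial; its cofactor is taken constant in y, which is the case for the
    curves considered (see [cofactor_const]). *)
Definition darboux P lam := vfield P = lam%:P * P.

Lemma vfieldM P Q : vfield (P * Q) = vfield P * Q + P * vfield Q.
Proof. by rewrite /vfield dxM derivM; ring. Qed.

Lemma vfield_XsubC y : E y = 0 -> vfield ('X - y%:P) = - (y^' + lop f)%:P * ('X - y%:P).
Proof.
move=> /(congr1 polyC); rewrite /residual polyC0 !polyCD !polyCM => h.
have -> : vfield ('X - y%:P) = - ('X * (y^')%:P) - ((lop f)%:P * 'X + (lop g)%:P).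
  rewrite /vfield derivB derivX derivC subr0 mulr1 -polyCN dxD dxX dxC lderivN.
  by rewrite polyCN add0r mulrN.
by apply/eqP; rewrite -subr_eq0; apply/eqP; rewrite -[RHS]oppr0 -h; ring.
Qed.

(** Along a solution y the vector field acts as y d/dx. *)
Lemma darboux_eval P lam y : E y = 0 -> darboux P lam ->
  y * (P.[y])^' = lam * P.[y].
Proof.
move=> ey /(congr1 (horner^~ y)); rewrite /vfield !hornerE lderiv_horner => <-.
have -> : lop g = - (y * y^' + lop f * y) by apply/eqP; rewrite -addr_eq0 addrC -ey.
by ring.
Qed.

Lemma darboux_factor Q lam y : E y = 0 -> darboux (Q * ('X - y%:P)) lam ->
  darboux Q (lam + (y^' + lop f)).
Proof.
move=> ey; rewrite /darboux vfieldM vfield_XsubC// => h.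
apply: (monic_rreg (monicXsubC y)); rewrite polyCD.
by move/eqP: h; rewrite -subr_eq0 => /eqP h; apply/eqP; rewrite -subr_eq0;
  apply/eqP; rewrite -[RHS]h; ring.
Qed.

(** The substitution y = q + w. The coefficients of the new vector field are the
    slope q' + f and the residual of q, both small when q is an approximate
    solution. *)
Lemma darboux_shift P lam q (G := P \Po ('X + q%:P)) : darboux P lam ->
  (q%:P + 'X) * dx G - ((q^' + lop f)%:P * 'X + (E q)%:P) * G^`() = lam%:P * G.
Proof.
move=> /(congr1 (comp_poly ('X + q%:P))).
rewrite /vfield !comp_polyB !comp_polyM comp_polyD comp_polyM !comp_polyC comp_polyX.
rewrite -/G => <-; rewrite /G dx_comp deriv_comp dxD dxX dxC add0r.
rewrite derivD derivX derivC addr0 mulr1 /residual !polyCD !polyCM.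
by ring.
Qed.

Lemma darboux_shift_coef G q h r lam i :
    (q%:P + 'X) * dx G - (h%:P * 'X + r%:P) * G^`() = lam%:P * G ->
  q * (G`_i)^' = lam * G`_i + h * (G`_i *+ i) + r * (G`_i.+1 *+ i.+1)
    - ('X * dx G)`_i.
Proof.
move=> /(congr1 (fun P => P`_i)); rewrite !mulrDl -mulrA coefB !coefD.
rewrite !coefCM !coef_dx !coef_deriv (coefXM G^`()).
have -> : (if i == 0%N then 0 else G^`()`_i.-1) = G`_i *+ i.
  by case: i => [|i]; rewrite ?mulr0n ?coef_deriv.
by move=> /eqP; rewrite subr_eq => /eqP e; apply/eqP; rewrite eq_sym subr_eq e;
  apply/eqP; ring.
Qed.

End Darboux.

Section Bounded.
Variables (C : numFieldType) (m M : nat) (G : {poly laurent C}).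
Variables (q h r lam : laurent C) (a : C).
Notation "a ^'" := (laurent_deriv a).
(* Here q is an approximate solution with leading coefficient a, h and r are
   its slope q' + f and its residual, and G is the polynomial in w = y - q. *)
Hypotheses (dq : deg_le q m.+1) (qa : q m.+1 = a) (a0 : a != 0).
Hypotheses (dh : deg_le h (m%:Z - 1)) (dr : deg_le r m) (dl : deg_le lam (m%:Z - 1)).
Hypotheses (GM : G`_M = 1) (Ggt : forall i, (M < i)%N -> G`_i = 0).
Hypothesis eqG :
  (q%:P + 'X) * dx G - (h%:P * 'X + r%:P) * G^`() = lam%:P * G.

(** Let B + 1 > 0 bound the degrees of all coefficients. In the equation for
    the coefficient of w^i, the term q G_i' alone reaches degree m + B + 1,
    apart from r G_(i+1), which is handled by descending induction from the
    leading coefficient 1. So the bound improves to B. This says that all roots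
    of G have degree at most 0, without constructing them. *)
Lemma coef_bounded i : deg_le G`_i 0.
Proof.
have [B hB] : exists B : nat, forall i, deg_le G`_i B.
  exists (\max_(i < M.+1) pick_bound (G`_i)%R) => j k hk.
  have [lt|] := ltnP M j; first by rewrite Ggt.
  rewrite -ltnS => jM; apply: pick_boundP.
  apply: le_lt_trans hk; rewrite lez_nat.
  exact: (leq_bigmax (F := fun i : 'I_M.+1 => pick_bound (G`_i)%R) (Ordinal jM)).
elim: B hB i => // B IH hB; apply: IH => i k ltk.
have [lt|] := ltrP B.+1%:Z k; first by apply: hB.
move=> le; have {ltk le} -> : k = B.+1%:Z by lia.
have [n le] := ubnP (M - i)%N; elim: n i le => // n IHn i le.
have [lt|gt|->] := ltngtP i M; last 2 first.
- by rewrite Ggt.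
- by rewrite GM.
have := congr1 (fun a : laurent C => a (m.+1%:Z + (B.+1%:Z - 1))) (darboux_shift_coef i eqG).
have small (x y : laurent C) : deg_le x (m%:Z - 1) -> deg_le y B.+1 ->
    (x * y) (m.+1%:Z + (B.+1%:Z - 1)) = 0.
  by move=> dx dy; apply: (deg_leM dx dy); lia.
rewrite (coef_topM dq (deg_le_lderiv (hB i)))// laurentB !laurentD.
rewrite (small lam)// (small h)//; last exact: deg_leMn.
rewrite (coef_topM dr (deg_leMn _ (hB i.+1))); last by lia.
rewrite laurentMn IHn; last by lia.
rewrite (_ : lcoef ('X * dx G)`_i _ = 0); last first.
  rewrite coefXM coef_dx; case: (i) => // i'.
  by apply: (deg_le_lderiv (hB i')); lia.
rewrite mul0rn mulr0 !add0r oppr0 lderivE subrK qa => /eqP.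
by rewrite mulf_eq0 (negbTE a0)/= -mulrzr mulf_eq0 intr_eq0 orbF => /eqP.
Qed.

(** The coefficient of w^(M-1), in degree m: all terms but M r are now of lower
    degree, because the derivative of a series of degree 0 has degree at most
    -2. Thus the mere existence of a curve with M > 0 forces the compatibility
    condition. *)
Lemma coef_compat : (0 < M)%N -> r m = 0.
Proof.
move=> M0; have cb := coef_bounded; pose i := M.-1; have Mi : M = i.+1 by rewrite prednK.
have := congr1 (fun a : laurent C => a (m.+1%:Z + (0 - 1))) (darboux_shift_coef i eqG).
have small (x y : laurent C) : deg_le x (m%:Z - 1) -> deg_le y 0 ->
    (x * y) (m.+1%:Z + (0 - 1)) = 0.
  by move=> dx dy; apply: (deg_leM dx dy); lia.
rewrite (coef_topM dq (deg_le_lderiv (cb i)))// laurentB !laurentD.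
rewrite (small lam)// (small h)//; last exact: deg_leMn.
rewrite -Mi GM (coef_topM dr (deg_leMn _ (@deg_le1 C))); last by lia.
rewrite laurentMn laurent1E lderivE subrK mulr0z mulr0.
rewrite (_ : lcoef ('X * dx G)`_i _ = 0); last first.
  rewrite coefXM coef_dx; case: (i) => // i'.
  by apply: (deg_le_lderiv (cb i')); lia.
rewrite !add0r subr0 eqxx => /esym/eqP; rewrite mulf_eq0 => /orP[/eqP//|].
by rewrite pnatr_eq0 => /eqP MM; rewrite MM in M0.
Qed.

(** Setting x = oo is a ring morphism on series of degree at most 0. *)
Lemma horner_bounded v : deg_le v 0 -> deg_le G.[v] 0 /\
  G.[v] 0 = (\poly_(i < M.+1) (G`_i 0)).[v 0].
Proof.
move=> dv; have cb := coef_bounded.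
have dvi i : deg_le (v ^+ i) 0 /\ (v ^+ i) 0 = v 0 ^+ i.
  elim: i => [|i [d e]]; first by split; [exact: deg_le1|rewrite laurent1E].
  by rewrite !exprS -e; split; [exact: (deg_leM dv d)|exact: (coef_topM dv d)].
have sG : (size G <= M.+1)%N by apply/leq_sizeP => j /Ggt.
rewrite (horner_coef_wide _ sG); split.
  elim/big_ind: _ => [|x y|i _]; [exact: deg_le0|exact: deg_leD|].
  by case: (dvi i) => d _; exact: (deg_leM (cb i) d).
rewrite laurent_sum (horner_coef_wide _ (size_poly _ _)).
apply: eq_bigr => i _; rewrite coef_poly ltn_ord; have [d <-] := dvi i.
exact: (coef_topM (cb i) d).
Qed.

End Bounded.

Lemma comp_XaddC_coef (K : comNzRingType) (P : {poly K}) (q : K) M :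
  P \is monic -> size P = M.+1 ->
  (P \Po ('X + q%:P))`_M = 1 /\ (forall i, (M < i)%N -> (P \Po ('X + q%:P))`_i = 0).
Proof.
move=> mP sP; have sX i : size (('X + q%:P) ^+ i) = i.+1.
  by rewrite -[q]opprK polyCN size_exp_XsubC.
rewrite coef_comp_poly; split.
  rewrite sP big_ord_recr /= big1 ?add0r => [|i _]; last first.
    by rewrite [X in _ * X]nth_default ?mulr0// sX.
  have : ('X + q%:P) ^+ M \is monic by rewrite -[q]opprK polyCN monic_exp ?monicXsubC.
  rewrite monicE lead_coefE sX => /eqP ->; rewrite mulr1.
  by move: mP; rewrite monicE lead_coefE sP => /eqP.
move=> i Mi; rewrite coef_comp_poly sP big1// => j _.
by rewrite [X in _ * X]nth_default ?mulr0// sX; have := ltn_ord j; lia.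
Qed.

(** * Splitting into linear factors *)

Section Split.
Variables (C : numClosedFieldType) (m : nat) (f g : {poly C}).
Hypothesis size_f : size f = m.+1.
Notation lop := (@laurent_of_poly C).
Notation E := (residual f g).
Notation cls := (@has_lead C m).
Notation "a ^'" := (laurent_deriv a).
Variables (q : {poly C}) (yII : laurent C).
Hypotheses (sq : shape_q m f q) (rq : deg_le (E (lop q)) m).
Hypotheses (eII : E yII = 0) (dII : deg_le yII m).
Implicit Types (P : {poly laurent C}) (lam y : laurent C).

(** The value u of P at y satisfies y u' = lam u. If u had degree d < 0, the left
    side would have degree m + d exactly, and the right side less. *)
Lemma darboux_eval_eq0 P lam y : cls (typeI_lead m f) y -> E y = 0 -> darboux f g P lam ->
  deg_le lam (m%:Z - 1) -> deg_le P.[y] (-1) -> P.[y] = 0.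
Proof.
move=> [dy yl] ey dP dl du; apply/eqP; apply: contraT => /deg_exists[d dd nz].
have d0 : d < 0 by rewrite ltNge; apply: contraNN nz => h; rewrite du//; lia.
have := congr1 (fun a : laurent C => a (m.+1%:Z + (d - 1))) (darboux_eval ey dP).
rewrite (coef_topM dy (deg_le_lderiv dd))// (deg_leM dl dd); last by lia.
rewrite yl lderivE subrK => /eqP.
by rewrite mulf_eq0 (negbTE (typeI_lead_neq0 size_f)) /= mulrz_eq0 (negbTE nz) orbF lt_eqF.
Qed.

(** The value u of P at yII satisfies yII u' = lam u, so that the degree of lam is
    at most that of yII minus 1. *)
Lemma deg_cofactor_lt P lam : darboux f g P lam -> P.[yII] != 0 ->
  deg_le lam (m%:Z - 1).
Proof.
move=> dP /deg_exists[d dd nz]; have [/eqP->|/deg_exists[l dl nzl]] := boolP (lam == 0).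
  exact: deg_le0.
have := congr1 (fun a : laurent C => a (l + d)) (darboux_eval eII dP).
rewrite (coef_topM dl dd)//; have [lt|le _] := leP m%:Z l; last first.
  by apply: deg_le_trans dl _; lia.
rewrite (deg_leM dII (deg_le_lderiv dd)); last by lia.
by move=> /esym/eqP; rewrite mulf_eq0 (negbTE nz) (negbTE nzl).
Qed.

(** The root is constructed from its constant term: G has a reduction at
    x = oo which is a monic polynomial over C, any root c of it gives a solution
    y with constant term c, and P(y) then has negative degree, which is only
    possible for P(y) = 0. *)
Lemma darboux_root_I P lam N : P \is monic -> size P = N.+2 -> darboux f g P lam ->
    deg_le lam (m%:Z - 1) ->
  exists y, [/\ E y = 0, cls (typeI_lead m f) y & P.[y] = 0].
Proof.
move=> mP sP dP dl; have qc := shape_q_lead sq.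
have [GM Ggt] := comp_XaddC_coef (lop q) mP sP.
have eqG := darboux_shift (lop q) dP.
set G := P \Po _ in GM Ggt eqG.
have dh : deg_le ((lop q)^' + lop f) (m%:Z - 1).
  move=> i hi; have [lt|le] := ltrP m%:Z i.
    exact: (deg_le_slope (leq_size_f size_f) qc).
  have -> : i = m by lia.
  by rewrite (coef_slope (leq_size_f size_f) qc) (typeI_leadM m f) addNr.
have aN0 := typeI_lead_neq0 size_f.
have rm := coef_compat qc.1 qc.2 aN0 dh rq dl GM Ggt eqG (ltn0Sn N).
have /closed_rootP[c rc] : size (\poly_(i < N.+2) (G`_i 0)) != 1%N.
  by rewrite size_poly_eq ?GM ?laurent1E ?eqxx ?oner_eq0.
have [y ey [yc dy]] := typeI_exists size_f c sq rq rm.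
exists y; split=> //; apply: (darboux_eval_eq0 yc ey dP dl).
pose v := y - lop q.
have v0 : v 0 = c.
  have := dy 0; rewrite laurentB => /(_ isT)/subr0_eq; rewrite /v => ->.
  by rewrite (ofpoly_nat _ 0) coefC.
have dv : deg_le v 0.
  rewrite -[v](subrK (lop c%:P)); apply: deg_leD.
    by apply: deg_le_trans dy _.
  by apply: deg_le_ofpoly; rewrite size_polyC; case: eqP.
have [d e] := horner_bounded qc.1 qc.2 aN0 dh rq dl GM Ggt eqG dv.
have -> : P.[y] = G.[v] by rewrite /G horner_comp !hornerE subrK.
move=> i hi; have [lt|le] := ltrP 0 i; first exact: d.
have -> : i = 0 by lia.
by rewrite e v0; apply/eqP.
Qed.

(** Either yII is a root, or the cofactor is small and there is a root of type
    (I). The quotient by the linear factor is again a Darboux polynomial. *)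
Lemma darboux_split N P lam : P \is monic -> size P = N.+1 -> darboux f g P lam ->
  exists s : seq (laurent C), [/\ size s = N, P = \prod_(y <- s) ('X - y%:P),
    forall y, y \in s -> E y = 0 /\ (y = yII \/ cls (typeI_lead m f) y)
    & lam = - \sum_(y <- s) (y^' + lop f)].
Proof.
elim: N P lam => [|N IH] P lam mP sP dP.
  exists [::]; rewrite !big_nil.
  have P1 : P = 1.
    have /size1_polyC e : (size P <= 1)%N by rewrite sP.
    by move: mP; rewrite e monicE lead_coefC => /eqP ->.
  split=> //; move: dP; rewrite P1 /darboux /vfield dxC lderiv1 derivC !mulr0 mulr1.
  by rewrite subr0 => /esym/eqP; rewrite polyC_eq0 => /eqP ->; rewrite oppr0.
have [y [ey ty /eqP/factor_theorem[Q eP]]] : exists y,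
    [/\ E y = 0, y = yII \/ cls (typeI_lead m f) y & P.[y] = 0].
  have [r|r] := boolP (P.[yII] == 0); first by exists yII; split=> //; [left|apply/eqP].
  have [y [ey cy ry]] := darboux_root_I mP sP dP (deg_cofactor_lt dP r).
  by exists y; split=> //; right.
have mQ : Q \is monic by move: mP; rewrite eP monicMr ?monicXsubC.
have sQ : size Q = N.+1.
  move: sP; rewrite eP size_Mmonic ?monic_neq0 ?monicXsubC// size_XsubC addn2.
  by case.
rewrite eP in dP; have [s [ss es hs ls]] := IH _ _ mQ sQ (darboux_factor ey dP).
exists (y :: s); split=> /=.
- by rewrite ss.
- by rewrite big_cons eP es mulrC.
- by move=> z; rewrite inE => /orP[/eqP->|/hs].
- by rewrite big_cons opprD -ls addrC addrK.
Qed.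

End Split.

Section Squarefree.
Variable C : closedFieldType.
Implicit Types (F H Q : {poly {poly C}}) (c : {poly C}).

(** A form of the Gauss lemma: irreducibility over C[x] excludes factorizations
    up to a scalar of C[x]. A root a of the scalar c annihilates H or Q modulo
    x - a, so x - a can be cancelled, until c is constant. *)
Lemma irreducible_scale_factor F H Q c : irreducible_elt F -> c != 0 ->
  c *: F = H * Q -> (size H <= 1)%N || (size Q <= 1)%N.
Proof.
move=> [F0 Fu irr]; have [k] := ubnP (size c); elim: k c H Q => // k IH c H Q sc c0 e.
have [sc1|/closed_rootP[a]] := eqVneq (size c) 1%N.
  have cu : c \is a GRing.unit.
    rewrite poly_unitE sc1 eqxx unitfE /=.
    have := lead_coef_eq0 c; rewrite lead_coefE sc1 => ->; exact: c0.
  have [||] := irr (c^-1 *: H) Q.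
  - by rewrite -scalerAl -e scalerA mulVr ?scale1r.
  - rewrite poly_unitE => /andP[/eqP sH _]; rewrite size_scale ?invr_eq0// in sH.
    by rewrite sH.
  - by rewrite poly_unitE => /andP[/eqP-> _]; rewrite orbT.
move=> /factor_theorem[c' ec].
have [c'0 sc'] : c' != 0 /\ (size c' < k)%N.
  have c'0 : c' != 0 by apply: contraNneq c0 => h; rewrite ec h mul0r.
  by split=> //; move: sc; rewrite ec size_Mmonic ?monicXsubC// size_XsubC addn2.
pose ev : {poly {poly C}} -> {poly C} := map_poly (horner_eval a).
have evP (A : {poly {poly C}}) : ev A = 0 -> exists A', A = ('X - a%:P) *: A'.
  move=> A0; exists (map_poly (fun p => p %/ ('X - a%:P)) A).
  apply/polyP => i; rewrite coefZ coef_map_id0 ?div0p// mulrC divpK//.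
  rewrite dvdp_XsubCl; apply/rootP.
  by have := congr1 (fun B : {poly C} => B`_i) A0; rewrite coef_map coef0.
have X0 : 'X - a%:P != 0 by rewrite polyXsubC_eq0.
have XI : injective ( *:%R ('X - a%:P) : {poly {poly C}} -> _).
  move=> A B; rewrite -!mul_polyC; apply: mulfI.
  by rewrite polyC_eq0.
have /eqP : ev H * ev Q = 0.
  rewrite -rmorphM /= -e; apply/polyP => i.
  by rewrite coef_map /= coefZ ec coef0 /horner_eval !hornerE subrr mulr0 mul0r.
rewrite mulf_eq0 => /orP[/eqP/evP[A eA]|/eqP/evP[A eA]].
- rewrite eA size_scale//; apply: (IH c' _ _ sc' c'0).
  by apply: XI; rewrite scalerA mulrC -ec e eA scalerAl.
- rewrite eA size_scale//; apply: (IH c' _ _ sc' c'0).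
  by apply: XI; rewrite scalerA mulrC -ec e eA scalerAr.
Qed.

End Squarefree.

(** * Invariant curves over the polynomial ring *)

Lemma deriv_eq0_size (C : numDomainType) (p : {poly C}) : p^`() = 0 -> (size p <= 1)%N.
Proof.
move=> p0; apply/leq_sizeP => -[//|i] _; have := congr1 (fun r : {poly C} => r`_i) p0.
by rewrite coef_deriv coef0 => /eqP; rewrite mulrn_eq0 => /eqP.
Qed.

Lemma prod_double_root (K : comNzRingType) (s : seq K) : ~~ uniq s ->
  exists y, (\prod_(z <- s) ('X - z%:P)).[y] = 0 /\
    (\prod_(z <- s) ('X - z%:P))^`().[y] = 0.
Proof.
elim: s => //= z s IH; rewrite negb_and negbK => h.
have [y [y1 y2]] : exists y, ('X - z%:P).[y] * (\prod_(z <- s) ('X - z%:P)).[y] = 0 /\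
   (\prod_(z <- s) ('X - z%:P)).[y] +
   ('X - z%:P).[y] * (\prod_(z <- s) ('X - z%:P))^`().[y] = 0.
  case/orP: h => [zs|/IH[y [h1 h2]]]; last by exists y; rewrite h1 h2 !mulr0 addr0.
  exists z; rewrite (big_rem z zs) /= hornerM hornerXsubC subrr !mul0r addr0.
  by [].
exists y; rewrite big_cons hornerM y1 derivM hornerD !hornerM derivXsubC hornerC mul1r.
by rewrite y2.
Qed.

Section InvariantCurve.
Variables (C : numClosedFieldType) (f g : {poly C}) (F : {poly {poly C}}).
Notation lop := (@laurent_of_poly C).
Notation mapl := (map_poly lop).

(** A Bezout relation between F and F' in C[x][y] would put a nonzero constant
    of C[x] to zero; otherwise F and F' share a factor of positive degree in y,
    which contradicts irreducibility. *)
Lemma irreducible_no_double_root y : irreducible_elt F -> (1 < size F)%N ->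
  (mapl F).[y] = 0 -> (mapl F)^`().[y] = 0 -> False.
Proof.
move=> irr sF r1 r2; have F0 : F != 0 by case: irr.
have dF0 : F^`() != 0.
  apply/eqP => /(congr1 (fun P : {poly {poly C}} => P`_(size F).-2)).
  rewrite coef_deriv coef0 (_ : (size F).-2.+1 = (size F).-1); last by lia.
  rewrite -lead_coefE -scaler_nat => /eqP; rewrite scale_poly_eq0 lead_coef_eq0.
  by rewrite (negbTE F0) orbF pnatr_eq0; lia.
have [/Bezout_coprimepP[[u v]]|ncop] := boolP (coprimep F F^`()).
  rewrite -size_poly_eq1 /= => /size_poly1P[d d0 e].
  have := congr1 (fun P => (mapl P).[y]) e.
  rewrite rmorphD !rmorphM /= -deriv_map hornerD !hornerM r1 r2 !mulr0 addr0.
  rewrite map_polyC hornerC -(rmorph0 lop) => /ofpoly_inj h.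
  by rewrite -h eqxx in d0.
have gF := dvdp_gcdl F F^`(); have gF' := dvdp_gcdr F F^`().
set G := gcdp F F^`() in gF gF'.
have G0 : G != 0 by rewrite gcdp_eq0 (negbTE F0).
have sG : (1 < size G)%N.
  by rewrite ltn_neqAle size_poly_gt0 G0 andbT eq_sym -coprimep_def.
have [[c Q] /= c0 e] := Pdiv.Idomain.dvdpP _ _ gF.
have Q0 : Q != 0.
  by apply: contraNneq F0 => h; move/eqP: e; rewrite h mul0r scale_poly_eq0 (negbTE c0).
have := irreducible_scale_factor irr c0 e; rewrite [(size G <= 1)%N]leqNgt sG orbF => sQ.
have lt_G_F := leq_ltn_trans (dvdp_leq dF0 gF') (lt_size_deriv F0).
have := congr1 (fun P : {poly {poly C}} => size P) e.
rewrite size_scale// size_mul// => eF; move: lt_G_F; rewrite ltnNge => /negP[].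
rewrite eF -subn1 leq_subLR leq_add2r; exact: sQ.
Qed.

Lemma vfield_map : vfield f g (mapl F) =
  mapl ('X * derivx F - (f%:P * 'X + g%:P) * F^`()).
Proof.
rewrite /vfield; have -> : dx (mapl F) = mapl (derivx F).
  apply/polyP => i; rewrite /derivx coef_dx !coef_map /=.
  exact: ofpoly_deriv.
rewrite rmorphB !rmorphM rmorphD rmorphM /= !map_polyC !map_polyX.
by rewrite deriv_map.
Qed.

(** Compare leading coefficients in y: a coefficient of the left side beyond y^N
    is zero or the derivative of the leading coefficient of F, which has smaller
    degree in x than any nonzero multiple of that coefficient. *)
Lemma cofactor_const lam : F != 0 -> is_cofactor f g F lam ->
  exists l, lam = l%:P /\ exists2 mu, mu != 0 & lead_coef F = mu%:P.
Proof.
rewrite /is_cofactor => F0; set W := 'X * _ - _ => e; pose N := (size F).-1.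
have sF : size F = N.+1 by rewrite prednK ?lt0n ?size_poly_eq0.
have WN i : (N < i)%N -> W`_i = (F`_i.-1)^`().
  have Fgt j : (N < j)%N -> F`_j = 0 by move=> ?; rewrite nth_default ?sF.
  case: i => // i Ni; rewrite /W mulrDl -mulrA coefB coefD coefCM !coefXM coefCM.
  have -> : (derivx F)`_i.+1.-1 = (F`_i)^`() by rewrite coef_map_id0 ?deriv0.
  rewrite !coef_deriv (Fgt i.+1 Ni) (Fgt i.+2 (leqW Ni)).
  by rewrite !mul0rn !mulr0 addr0 subr0.
have sl : (size lam <= 1)%N.
  rewrite leqNgt; apply/negP => sl; have l0 : lam != 0 by rewrite -size_poly_gt0 ltnW.
  have := size_mul l0 F0; rewrite -e sF addnS /= => sW.
  have [k sk] : exists k, size lam = k.+2 by exists (size lam).-2; lia.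
  have WL : W`_(k.+1 + N) = lead_coef lam * lead_coef F.
    by rewrite -lead_coefM -e lead_coefE sW sk.
  have WS : W`_(k.+1 + N) = (F`_(k + N))^`() by rewrite WN// ltnS leq_addl.
  have LF0 : lead_coef F != 0 by rewrite lead_coef_eq0.
  have : (size (lead_coef F) <= size (W`_(k.+1 + N))%R)%N.
    rewrite WL size_mul ?lead_coef_eq0// -subn1 -addnBAC ?size_poly_gt0 ?lead_coef_eq0//.
    exact: leq_addl.
  rewrite leqNgt => /negP; apply; rewrite WS; case: k {sk WL WS} => [|k].
    by rewrite add0n -lead_coefE lt_size_deriv.
  by rewrite nth_default ?sF ?ltnS ?leq_addl// deriv0 size_poly0 size_poly_gt0.
have [l el] : exists l, lam = l%:P by exists lam`_0; exact: size1_polyC.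
exists l; split=> //.
have : (lead_coef F)^`() = 0.
  rewrite lead_coefE -[(size F).-1]/N -[N in F`_N]/(N.+1.-1) -WN// e el coefCM.
  by rewrite nth_default ?mulr0// sF.
move=> /deriv_eq0_size /size1_polyC h; exists (lead_coef F)`_0 => //.
by apply: contraNneq F0 => h0; rewrite -lead_coef_eq0 h h0.
Qed.

End InvariantCurve.

(** * The structure theorem *)

Section Structure.
Variables (C : numClosedFieldType) (m : nat) (f g : {poly C}).
Hypothesis size_f : size f = m.+1.
Notation lop := (@laurent_of_poly C).
Notation mapl := (map_poly lop).
Notation E := (residual f g).
Notation "a ^'" := (laurent_deriv a).

Lemma pos_part_map (F : {poly {poly C}}) : pos_part (mapl F) = F.
Proof.
apply/polyP => i; rewrite coef_map_id0 ?laurent_pos0// coef_map.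
exact: laurent_posK.
Qed.

(** The curve, made monic and read over the Laurent series, is a product of
    linear factors; irreducibility makes them distinct. As F is a polynomial, it
    is its own polynomial part. *)
Lemma invariant_curve_split (q : {poly C}) (yII : laurent C) F lam :
    shape_q m f q -> deg_le (E (lop q)) m -> E yII = 0 -> deg_le yII m ->
    invariant_curve f g F -> irreducible_elt F -> is_cofactor f g F lam ->
  exists s : seq (laurent C), exists mu l, [/\ uniq s, (0 < size s)%N,
    forall y, y \in s -> E y = 0 /\ (y = yII \/ has_lead m (typeI_lead m f) y),
    mu != 0 /\ F = mu%:P%:P * pos_part (\prod_(y <- s) ('X - y%:P))
    & lam = l%:P /\ lop l = - \sum_(y <- s) (y^' + lop f)].
Proof.
move=> sq rq eII dII [Fnc _] irr cof; have F0 : F != 0 by case: irr.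
have [l [el [mu mu0 lF]]] := cofactor_const F0 cof.
pose F1 := (mu^-1)%:P%:P * F.
have eF : F = mu%:P%:P * F1.
  by rewrite /F1 mulrA -!polyCM mulfV// !polyC1 mul1r.
have [N sF] : exists N, size F = N.+1.
  by exists (size F).-1; rewrite prednK ?size_poly_gt0.
have N0 : (0 < N)%N.
  rewrite lt0n; apply/eqP => h; apply: (Fnc mu).
  have := sF; rewrite h => /eqP/size_poly1P[c c0 ec].
  by rewrite ec -lF ec lead_coefC.
have mui0 : (mu^-1)%:P != 0 :> {poly C} by rewrite polyC_eq0 invr_eq0.
have lF1 : lead_coef F1 = 1.
  by rewrite /F1 mul_polyC lead_coefZ lF -polyCM mulVf.
have sF1 : size F1 = N.+1 by rewrite /F1 mul_polyC size_scale.
have sP : size (mapl F1) = N.+1.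
  by rewrite size_map_poly_id0 // lF1 rmorph1 oner_eq0.
have mP : mapl F1 \is monic.
  by rewrite monicE lead_coef_map_id0 ?rmorph0 ?lF1 ?rmorph1 ?oner_eq0.
have dP : darboux f g (mapl F1) (lop l).
  have v0 : vfield f g (lop (mu^-1)%:P)%:P = 0.
    rewrite /vfield dxC derivC ofpoly_deriv derivC rmorph0.
    by rewrite !mulr0 subrr.
  have := congr1 mapl cof; rewrite -vfield_map el rmorphM /= map_polyC => dF.
  rewrite /darboux /F1 rmorphM /= map_polyC vfieldM v0 mul0r add0r dF.
  by rewrite mulrCA.
have [s [ss es hs ls]] := darboux_split size_f sq rq eII dII mP sP dP.
exists s, mu, l; split=> //; last 2 first.
- by rewrite ss.
- by split=> //; rewrite -es pos_part_map.
apply: contraT => /prod_double_root[y]; rewrite -es => -[r1 r2].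
have [] := @irreducible_no_double_root _ F y irr; first by rewrite sF.
  by rewrite eF rmorphM /= map_polyC hornerM r1 mulr0.
by rewrite eF rmorphM /= map_polyC mul_polyC derivZ hornerZ r2 mulr0.
Qed.

End Structure.

Theorem theorem3p1 (R : realType) (m n : nat) (f g : {poly R[i]})
    (size_f : size f = m.+1) (size_g : size g = n.+1)
    (lt_mn : (m < n)%N) (lt_n2m : (n < 2 * m + 1)%N) :
  exists (q p : {poly R[i]}) (cII : nat -> R[i]),
  [/\ shape_q m f q /\ shape_p m n f g p,
      (* q is determined by the equation *)
      forall q' c, shape_q m f q' -> lienard_series f g (expansion q' c) ->
        q' = q,
      (* all coefficients of the type (I) series are determined by the one of
         x^0 *)
      forall c c', lienard_series f g (expansion q c) ->
        lienard_series f g (expansion q c') -> c 0%N = c' 0%N ->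
        forall l, c l = c' l,
      (* p and the coefficients of the type (II) series are determined by the
         equation *)
      forall p' c, shape_p m n f g p' ->
        lienard_series f g (expansion p' c) ->
        p' = p /\ forall l, c l = cII l
    & forall F lambda : {poly {poly R[i]}},
        invariant_curve f g F -> irreducible_elt F ->
        is_cofactor f g F lambda ->
        exists (N k : nat) (cI : 'I_(N - k) -> nat -> R[i]),
        [/\ [/\ (0 < N)%N, k = 0%N \/ k = 1%N
              & forall j, lienard_series f g (expansion q (cI j))],
            k = 1%N -> lienard_series f g (expansion p cII),
            injective (fun j => cI j 0%N),
            exists2 mu : R[i], mu != 0 &
              F = mu%:P%:P *
                pos_part ((\prod_(j < N - k) ('X - (expansion q (cI j))%:P))
                          * ('X - (expansion p cII)%:P) ^+ k)
          & lambda = (- (f *+ N) - q^`() *+ (N - k) - p^`() *+ k)%:P]].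
Proof.
have [q [sq rq]] := typeI_polynomial_exists size_f size_g lt_mn lt_n2m.
have [yII [eII dII lII]] := typeII_exists size_f size_g lt_mn lt_n2m.
pose p := principal_part yII; pose cII (l : nat) := yII (- l%:Z).
have p0 : p`_0 = 0 by rewrite coef_principal_part.
have yE : yII = expansion p cII := expansion_principal p0 (principal_partP yII).
have q0 : q`_0 = 0 by case/shapeP: sq.
have leadI c : has_lead m (typeI_lead m f) (expansion q c) by exact: shape_q_expansion_lead.
have leadII : has_lead m 0 yII by apply: (has_lead0_le _ dII); lia.
have sp : shape_p m n f g p.
  apply/shapeP; first by rewrite subn_gt0.
  split=> // [|i hi]; rewrite coef_principal_part.
    by rewrite gtn_eqF ?subn_gt0// lII.
  by rewrite gtn_eqF ?(leq_ltn_trans _ hi)// dII//; lia.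
have uI c c' : lienard_series f g (expansion q c) ->
        lienard_series f g (expansion q c') -> c 0%N = c' 0%N ->
        expansion q c = expansion q c'.
  move=> e e' c0; apply: (typeI_unique size_f e e' (leadI _) (leadI _)).
    case=> // i i0; rewrite laurentB !expansionE// i0 subrr//.
  by rewrite !expansionE//= c0.
exists q, p, cII; split=> //.
- move=> q' c sq' e.
  have q'0 : q'`_0 = 0 by case/shapeP: sq'.
  have := typeI_principal size_f sq rq (shape_q_expansion_lead _ sq') e.
  move=> /(expansion_principal q0) /(expansion_inj q'0 q0); by case.
- by move=> c c' e e' c0; have [] := expansion_inj q0 q0 (uI _ _ e e' c0).
- move=> p' c sp' e.
  have p'0 : p'`_0 = 0 by case/shapeP: sp' => //; rewrite subn_gt0.
  apply: (expansion_inj p'0 p0); rewrite -yE. 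
  exact: (typeII_unique size_f e eII (shape_p_expansion_lead c lt_mn lt_n2m sp') leadII).
move=> F lam inv irr cof.
have dIIm : deg_le yII m by apply: deg_le_trans dII _; lia.
have [s [mu [l [us s0 hs [mu0 eF] [el sl]]]]] :=
  invariant_curve_split size_f sq rq eII dIIm inv irr cof.
(* The roots of type (I); uniqueness of the roots puts yII at most once in s. *)
pose s1 := [seq y <- s | predC1 yII y]; pose k : nat := yII \in s.
have ps : perm_eq s (s1 ++ nseq k yII).
  rewrite /k; case: (boolP (yII \in s)) => [yin|yout] /=.
    apply: perm_trans (perm_to_rem yin) _; rewrite rem_filter// -/s1 cats1.
    by rewrite perm_sym perm_rcons.
  rewrite cats0 /s1 (_ : filter _ _ = s)//; apply/all_filterP/allP => y ys /=.
  by apply: contraNneq yout => <-.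
have hs1 y : y \in s1 -> residual f g y = 0 /\ y = expansion q (fun l => y (- l%:Z)).
  rewrite mem_filter /= => /andP[yN /hs[ey [yy|yc]]]; first by rewrite yy eqxx in yN.
  by split=> //; apply: (expansion_principal q0); exact: (typeI_principal size_f sq rq yc ey).
have szs : size s = (size s1 + k)%N by rewrite (perm_size ps) size_cat size_nseq.
have sk : (size s - k)%N = size s1 by rewrite szs addnK.
have ltk (j : 'I_(size s - k)) : (j < size s1)%N by rewrite -sk.
exists (size s), k, (fun j l => (nth 0 s1 j) (- l%:Z)).
have hj (j : 'I_(size s - k)) := hs1 _ (mem_nth 0 (ltk j)).
split.
- split=> //; first by rewrite /k; case: (_ \in _); [right|left].
  by move=> j; have [ej <-] := hj j.
- by rewrite -yE.
- move=> i j eij; have [ei xi] := hj i; have [ej xj] := hj j.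
  have : nth 0 s1 i = nth 0 s1 j.
    rewrite xi xj; apply: uI; rewrite -?xi -?xj//.
  move/eqP; rewrite nth_uniq ?ltk ?filter_uniq// => /eqP ij.
  exact: val_inj.
- exists mu => //; rewrite eF; congr (_ * pos_part _).
  rewrite (perm_big _ ps) big_cat /= big_nseq iter_mulr_1 -yE; congr (_ * _).
  rewrite (big_nth 0) big_mkord -sk; apply: eq_bigr => j _.
  by have [_ <-] := hj j.
(* The cofactor is polynomial, so only the terms of nonnegative degree of the
   sum of the y' + f matter, and there y' agrees with q' or p'. *)
rewrite el; congr _%:P; apply/polyP => i.
rewrite -[LHS]ofpoly_nat sl laurentN laurent_sum (perm_big _ ps) big_cat /=.
have dE (r : {poly R[i]}) c (j : nat) : r`_0 = 0 ->
    laurent_deriv (expansion r c) j%:Z = r^`()`_j.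
  move=> r0; rewrite lderivE (_ : j%:Z + 1 = j.+1%:Z); last by lia.
  by rewrite expansionE// coef_deriv -pmulrn.
have dpE : yII (i%:Z + 1) *~ (i%:Z + 1) = p^`()`_i.
  by rewrite -lderivE [in LHS]yE dE.
rewrite big_nseq iter_addr_0 dpE.
rewrite (eq_big_seq (fun=> q^`()`_i + f`_i)); last first.
  move=> y /hs1[_ yq]; have := dE q (fun l => y (- l%:Z)) i q0.
  by rewrite -yq lderivE => <-.
rewrite big_const_seq count_predT iter_addr_0 !coefB coefN !coefMn szs addnK.
by rewrite !mulrnDl mulrnDr; ring.
Qed.
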